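(* Let $\mathcal{X}\subset\mathbb{R}^n$ and let $\mathscr{M}$ be a finite set. Suppose that the target variables $\mathbf{g}:\mathcal{X}\to\mathbb{R}^q$ and measurements $\mathbf{m}_j:\mathcal{X}\to\mathbb{R}^{d_j}$, $j\in\mathscr{M}$, are measurable functions, and let $\mu$ and $\nu$ be measures on $\mathcal{X}$. Let $L>0$, and for $\mathscr{S}\subseteq\mathscr{M}$ define $$f(\mathscr{S})=\int_{\substack{(\mathbf{x},\mathbf{x}')\in\mathcal{X}\times\mathcal{X}:\\ \mathbf{g}(\mathbf{x})\neq\mathbf{g}(\mathbf{x}')}}g_{\mathbf{x},\mathbf{x}'}(\mathscr{S})\,d\mu(\mathbf{x})\,d\nu(\mathbf{x}'),\qquad g_{\mathbf{x},\mathbf{x}'}(\mathscr{S})=\min\left\{\frac{\Vert\mathbf{m}_{\mathscr{S}}(\mathbf{x})-\mathbf{m}_{\mathscr{S}}(\mathbf{x}')\Vert_2^2}{\Vert\mathbf{g}(\mathbf{x})-\mathbf{g}(\mathbf{x}')\Vert_2^2},\ \frac{1}{L^2}\right\},$$ and assume $f$ is finite-valued. Then $f$ is normalized so that $f(\emptyset)=0$, monotone non-decreasing so that $\mathscr{S}\subseteq\mathscr{S}'\Rightarrow f(\mathscr{S})\leq f(\mathscr{S}')$, and submodular.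
   Context: For $\mathscr{S}\subseteq\mathscr{M}$, $\mathbf{m}_{\mathscr{S}}=(\mathbf{m}_j)_{j\in\mathscr{S}}$ is the concatenated measurement, so $\Vert\mathbf{m}_{\mathscr{S}}(\mathbf{x})-\mathbf{m}_{\mathscr{S}}(\mathbf{x}')\Vert_2^2=\sum_{j\in\mathscr{S}}\Vert\mathbf{m}_j(\mathbf{x})-\mathbf{m}_j(\mathbf{x}')\Vert_2^2$. The integral is with respect to the product of $\mu$ and $\nu$. A real-valued function $f:2^{\mathscr{M}}\to\mathbb{R}$ on subsets of $\mathscr{M}$ is submodular if for all $j\in\mathscr{M}$ and $\mathscr{S}\subseteq\mathscr{S}'\subseteq\mathscr{M}\setminus\{j\}$, $f(\mathscr{S}\cup\{j\})-f(\mathscr{S})\geq f(\mathscr{S}'\cup\{j\})-f(\mathscr{S}')$. *)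

(* Defs.v *)
From HB Require Import structures.
From mathcomp Require Import all_boot all_order all_algebra.
From mathcomp Require Import all_classical all_reals all_analysis.

Set Implicit Arguments.
Unset Strict Implicit.
Unset Printing Implicit Defensive.

Import Order.TTheory GRing.Theory Num.Theory.
Import numFieldNormedType.Exports.
Local Open Scope classical_set_scope.
Local Open Scope ring_scope.

(* The topology of 'rV[R]_n is the product topology, so this is the usual
   Borel sigma-algebra of R^n. *)
Definition borel_rV (R : realType) (n : nat) :=
  g_sigma_algebraType (@open 'rV[R]_n).

HB.instance Definition _ (R : realType) (n : nat) :=
  Measurable.on (borel_rV R n).

(* The library's measurable types are pointed, hence the chosen x0 in X. *)
Definition pointed_subset (T : pointedType) (X : set T) (x0 : X) : Type := X.

HB.instance Definition _ (T : pointedType) (X : set T) (x0 : X) :=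
  Choice.copy (pointed_subset x0) X.
HB.instance Definition _ (T : pointedType) (X : set T) (x0 : X) :=
  isPointed.Build (pointed_subset x0) x0.

(* X with the trace of the Borel sigma-algebra: its measurable sets are the
   X `&` B with B Borel.  X itself need not be a Borel set. *)
Definition borel_subset (R : realType) (n : nat) (X : set 'rV[R]_n) (x0 : X) :=
  g_sigma_algebra_preimageType
    (set_val : pointed_subset x0 -> borel_rV R n).

HB.instance Definition _ (R : realType) (n : nat) (X : set 'rV[R]_n) (x0 : X) :=
  Measurable.on (borel_subset x0).

(* The norm `|u| of the library is the sup norm on 'rV[R]_n. *)
Definition norm2 (R : realType) (n : nat) (u : 'rV[R]_n) : R :=
  Num.sqrt (\sum_(k < n) u 0 k ^+ 2).

Definition concat (R : realType) (M : finType) (d : M -> nat) (T : Type)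
    (m : forall j : M, T -> 'rV[R]_(d j)) (S : {set M}) (x : T)
    : 'rV[R]_(\sum_(k < #|S|) d (enum_val k)) :=
  \mxrow_(k < #|S|) m (enum_val k) x.

Lemma norm2_concatB (R : realType) (M : finType) (d : M -> nat) (T : Type)
    (m : forall j : M, T -> 'rV[R]_(d j)) (S : {set M}) (x x' : T) :
  norm2 (concat m S x - concat m S x') ^+ 2
  = \sum_(j in S) norm2 (m j x - m j x') ^+ 2.
Proof.
have nE n (u : 'rV[R]_n) : norm2 u ^+ 2 = \sum_(k < n) u 0 k ^+ 2.
  by rewrite sqr_sqrtr// sumr_ge0// => k _; exact: sqr_ge0.
rewrite nE /concat.
have -> (A B : 'rV[R]_(\sum_(k < #|S|) d (enum_val k))) :
  \sum_k (A - B) 0 k ^+ 2 = ((A - B) *m (A - B)^T) 0 0.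
  by rewrite mxE; apply: eq_bigr => k _; rewrite !mxE expr2.
rewrite -mxrowB tr_mxrow mul_mxrow_mxcol summxE.
rewrite [RHS]big_enum_val.
apply: eq_bigr => k _; rewrite nE mxE; apply: eq_bigr => i _.
by rewrite !mxE expr2.
Qed.

(* Determines pi when mu and nu are sigma-finite; in general a product measure
   exists (Caratheodory) but need not be unique. *)
Definition is_product_measure d1 d2 (T1 : measurableType d1)
    (T2 : measurableType d2) (R : realType)
    (mu : {measure set T1 -> \bar R}) (nu : {measure set T2 -> \bar R})
    (pi : {measure set (T1 * T2) -> \bar R}) :=
  forall A B, measurable A -> measurable B ->
    pi (A `*` B) = (mu A * nu B)%E.

Lemma product_measure1_is_product d1 d2 (T1 : measurableType d1)
    (T2 : measurableType d2) (R : realType)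
    (mu : {measure set T1 -> \bar R})
    (nu : {sigma_finite_measure set T2 -> \bar R}) :
  is_product_measure mu nu (mu \x nu)%E.
Proof. by move=> A B mA mB; exact: product_measure1E. Qed.

Definition g_pair (R : realType) (M : finType) (d : M -> nat) (q : nat)
    (T : Type) (g : T -> 'rV[R]_q) (m : forall j : M, T -> 'rV[R]_(d j))
    (L : R) (x x' : T) (S : {set M}) : R :=
  Num.min
    (norm2 (concat m S x - concat m S x') ^+ 2 / norm2 (g x - g x') ^+ 2)
    (1 / L ^+ 2).

Definition f_int (R : realType) (M : finType) (d : M -> nat) (q : nat)
    dT (T : measurableType dT) (pi : {measure set (T * T) -> \bar R})
    (g : T -> 'rV[R]_q) (m : forall j : M, T -> 'rV[R]_(d j))
    (L : R) (S : {set M}) : \bar R :=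
  (\int[pi]_(z in [set z : T * T | g z.1 <> g z.2])
     (g_pair g m L z.1 z.2 S)%:E)%E.

Definition normalized (R : realType) (M : finType) (f : {set M} -> R) :=
  f finset.set0 = 0.

Definition monotone_nondecreasing (R : realType) (M : finType) (f : {set M} -> R) :=
  forall S S' : {set M}, S \subset S' -> f S <= f S'.

Definition submodular (R : realType) (M : finType) (f : {set M} -> R) :=
  forall (j : M) (S S' : {set M}), S \subset S' -> S' \subset (~: [set j])%SET ->
    f (S :|: [set j])%SET - f S >= f (S' :|: [set j])%SET - f S'.

(* Main.v *)
Require Import Defs.
From mathcomp Require Import all_boot all_order all_algebra.
From mathcomp Require Import all_classical all_reals all_analysis.
From mathcomp Require Import measurable_realfun.
From mathcomp Require Import lra.

Set Implicit Arguments.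
Unset Strict Implicit.
Unset Printing Implicit Defensive.

Import Order.TTheory GRing.Theory Num.Theory.
Import numFieldNormedType.Exports.
Local Open Scope classical_set_scope.
Local Open Scope ring_scope.

(** For a fixed pair (x, x'), the squared norm of a concatenation is the sum of
    the squared norms of its blocks, so g_(x,x')(S) is the minimum of a constant
    and a sum, over j in S, of nonnegative weights that do not depend on S
    ([g_pairE]).  Truncating such a sum from above preserves its value 0 at the
    empty set and its monotonicity, and it can only destroy marginal gains: the
    gain from j is cut once the cap is reached, and a larger set reaches it
    sooner ([truncated_sum_submodular]).

    The three properties are linear relations between the values of a set
    function, so they survive integration as long as the integrals are finite
    ([integral_submodular]).  To use additivity of the integral, the integrand
    and the domain where g(x) <> g(x') must be measurable; both are expressed by
    the squared distances |u(x) - u(x')|^2, which are polynomials in the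
    coordinates ([measurable_g_pair], [measurable_neq]). *)

(** As functions of s, both s |-> min (s + t) c and s |-> min s c are eventually
    constant; their difference decreases from t to 0. *)
Lemma min_add_diminishing (R : realDomainType) (s s' t c : R) :
  s <= s' -> 0 <= t ->
  Num.min (s' + t) c - Num.min s' c <= Num.min (s + t) c - Num.min s c.
Proof.
move=> ss' t0; rewrite /Num.min.
case: (ltP (s' + t) c) => ?; case: (ltP s' c) => ?;
  case: (ltP (s + t) c) => ?; case: (ltP s c) => ?; lra.
Qed.

Lemma truncated_sum_submodular (R : realType) (M : finType) (w : M -> R) (c : R) :
  0 <= c -> (forall j, 0 <= w j) ->
  let F := fun S : {set M} => Num.min (\sum_(j in S) w j) c in
  [/\ normalized F, monotone_nondecreasing F & submodular F].
Proof.
move=> c0 w0 F.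
have le_sum (S S' : {set M}) : S \subset S' ->
    \sum_(j in S) w j <= \sum_(j in S') w j.
  move=> SS'; rewrite [leRHS](big_setID S)/= (finset.setIidPr SS') lerDl.
  exact: sumr_ge0.
split.
- by rewrite /normalized /F big_set0; apply/min_idPl.
- by move=> S S' SS'; rewrite /F le_min2 // le_sum.
- move=> j S S' SS' S'j.
  have jS' : j \notin S'.
    by apply/negP => /(fintype.subsetP S'j); rewrite !inE eqxx.
  have jS : j \notin S by apply: contra jS'; exact: (fintype.subsetP SS').
  rewrite /F !(finset.setUC _ [set j]%SET) !big_setU1//= !(addrC (w j)).
  by apply: min_add_diminishing; rewrite ?le_sum.
Qed.

(** Submodularity is integrated in the subtraction-free form
    F (S' + j) + F S <= F (S + j) + F S', because additivity of the integral is
    available for nonnegative functions; integrability of each F S is used only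
    afterwards, to rearrange the inequality between real numbers. *)
Lemma integral_submodular (R : realType) (M : finType) dT
    (T : measurableType dT) (mu : {measure set T -> \bar R}) (D : set T)
    (F : T -> {set M} -> R) (I := fun S => (\int[mu]_(z in D) (F z S)%:E)%E) :
  measurable D ->
  (forall S, measurable_fun D (F^~ S)) ->
  (forall z, [/\ normalized (F z), monotone_nondecreasing (F z)
               & submodular (F z)]) ->
  (forall S, I S \is a fin_num) ->
  let f := fun S => fine (I S) in
  [/\ normalized f, monotone_nondecreasing f & submodular f].
Proof.
move=> mD mF hF fin f.
have mFE S : measurable_fun D (fun z => (F z S)%:E) by exact/measurable_EFinP.
have F0 z S : 0 <= F z S.
  (* F z vanishes at the empty set and is monotone, hence nonnegative. *)
  by have [nz mz _] := hF z; rewrite -nz; apply: mz; exact: finset.sub0set.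
have FE0 S z : D z -> (0 <= (F z S)%:E)%E by rewrite lee_fin.
split.
- rewrite /normalized /f /I integral0_eq// => z _.
  by have [-> _ _] := hF z.
- move=> S S' SS'; rewrite /f fine_le//; apply: ge0_le_integral => //.
  exact: FE0.
  by move=> z _; rewrite lee_fin; have [_ mz _] := hF z; exact: mz.
- move=> j S S' SS' S'j.
  set A := (S :|: _)%SET; set A' := (S' :|: _)%SET.
  have : (I A' + I S <= I A + I S')%E.
    rewrite /I -!ge0_integralD//; try exact: FE0.
    apply: ge0_le_integral => //.
    + by move=> z _; rewrite adde_ge0// lee_fin.
    + exact: emeasurable_funD.
    + exact: emeasurable_funD.
    + move=> z _; rewrite -!EFinD lee_fin; have [_ _ sz] := hF z.
      have := sz j S S' SS' S'j; rewrite -/A -/A'; lra.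
  rewrite -(fineK (fin A)) -(fineK (fin A')) -(fineK (fin S)) -(fineK (fin S')).
  rewrite -!EFinD lee_fin /f; lra.
Qed.

Lemma sqr_norm2 (R : realType) (n : nat) (u : 'rV[R]_n) :
  norm2 u ^+ 2 = \sum_(k < n) u 0 k ^+ 2.
Proof. by rewrite sqr_sqrtr// sumr_ge0// => k _; exact: sqr_ge0. Qed.

Lemma sqr_norm2_eq0 (R : realType) (n : nat) (u : 'rV[R]_n) :
  (norm2 u ^+ 2 == 0) = (u == 0).
Proof.
rewrite sqr_norm2 psumr_eq0; last by move=> k _; exact: sqr_ge0.
apply/allP/eqP => [u0|-> k _]; last by rewrite mxE expr0n/= eqxx.
apply/rowP => k; rewrite mxE; apply/eqP.
by have := u0 k (mem_index_enum _); rewrite sqrf_eq0.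
Qed.

(** Coordinates are continuous, and the sigma-algebra of R^n is the one
    generated by the open sets. *)
Lemma measurable_coord (R : realType) (n : nat) (k : 'I_n) :
  measurable_fun [set: borel_rV R n] (fun u : 'rV[R]_n => u 0 k).
Proof.
apply: (measurability _ (RGenOpens.measurableE R)) => _ [_ [a [b ->] <-]].
rewrite setTI; apply: sub_sigma_algebra.
move/continuousP: (@coord_continuous R 1 n 0 k); apply; exact: interval_open.
Qed.

Lemma measurable_sqr_dist (R : realType) dT (T : measurableType dT) (n : nat)
    (u : T -> borel_rV R n) : measurable_fun [set: T] u ->
  measurable_fun [set: T * T]
    (fun z => norm2 ((u z.1 : 'rV_n) - (u z.2 : 'rV_n)) ^+ 2).
Proof.
move=> mu.
under eq_fun do rewrite sqr_norm2.
apply: measurable_sum => k; apply: measurable_funX.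
under eq_fun do rewrite !mxE.
apply: measurable_funB.
- apply: (measurableT_comp (measurable_coord k)).
  exact: measurableT_comp measurable_fst.
- apply: (measurableT_comp (measurable_coord k)).
  exact: measurableT_comp measurable_snd.
Qed.

(** The set is the preimage of the complement of 0 under the squared distance;
    this reduces the question to a real-valued function, so that the diagonal of
    R^n x R^n need not be considered. *)
Lemma measurable_neq (R : realType) dT (T : measurableType dT) (n : nat)
    (u : T -> borel_rV R n) : measurable_fun [set: T] u ->
  measurable [set z : T * T | u z.1 <> u z.2].
Proof.
move=> mu.
rewrite (_ : [set _ | _] = setT `&`
  (fun z => norm2 ((u z.1 : 'rV_n) - (u z.2 : 'rV_n)) ^+ 2) @^-1` (~` [set 0])).
  by apply: measurable_sqr_dist => //; exact: measurableC.
rewrite setTI; apply/seteqP; split => z /= uz; apply: contra_not uz.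
- by move/eqP; rewrite sqr_norm2_eq0 subr_eq0 => /eqP.
- by move=> ->; apply/eqP; rewrite sqr_norm2_eq0 subrr.
Qed.

Lemma measurable_inv_nneg (R : realType) dT (T : measurableType dT) (D : set T)
    (h : T -> R) : (forall z, 0 <= h z) -> measurable_fun D h ->
  measurable_fun D (fun z => (h z)^-1).
Proof.
move=> h0 mh.
(* For nonnegative reals the inverse is the real power of exponent -1, which is
   measurable everywhere, including at 0. *)
under eq_fun do rewrite -powR_inv1//.
exact: (measurableT_comp (measurable_powR (-1))).
Qed.

(** The denominator is common to all blocks, so the ratio is a sum of weights
    attached to the single measurements. *)
Lemma g_pairE (R : realType) (M : finType) (d : M -> nat) (q : nat) (T : Type)
    (g : T -> 'rV[R]_q) (m : forall j : M, T -> 'rV[R]_(d j)) (L : R)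
    (x x' : T) (S : {set M}) :
  g_pair g m L x x' S =
  Num.min (\sum_(j in S) norm2 (m j x - m j x') ^+ 2 / norm2 (g x - g x') ^+ 2)
    (1 / L ^+ 2).
Proof. by rewrite /g_pair norm2_concatB mulr_suml. Qed.

Lemma measurable_g_pair (R : realType) (M : finType) (d : M -> nat) (q : nat)
    dT (T : measurableType dT) (g : T -> borel_rV R q)
    (m : forall j : M, T -> borel_rV R (d j)) (L : R) (S : {set M}) :
  measurable_fun [set: T] g -> (forall j, measurable_fun [set: T] (m j)) ->
  measurable_fun [set: T * T] (fun z => g_pair g m L z.1 z.2 S).
Proof.
move=> mg mm.
(* Measurability of finite sums is about a sequence of indices, not a set. *)
under eq_fun do rewrite g_pairE -big_enum/=.
apply: measurable_minr => //; apply: measurable_sum => j.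
apply: measurable_funM; first exact: measurable_sqr_dist.
apply: measurable_inv_nneg; last exact: measurable_sqr_dist.
by move=> z; exact: sqr_ge0.
Qed.

Theorem lemmaB4 (R : realType) (n q : nat) (X : set 'rV[R]_n) (x0 : X)
    (M : finType) (d : M -> nat)
    (g : borel_subset x0 -> borel_rV R q)
    (m : forall j : M, borel_subset x0 -> borel_rV R (d j))
    (mu nu : {measure set (borel_subset x0) -> \bar R})
    (pi : {measure set (borel_subset x0 * borel_subset x0) -> \bar R})
    (L : R)
    (hg : measurable_fun [set: borel_subset x0] g)
    (hm : forall j : M, measurable_fun [set: borel_subset x0] (m j))
    (hpi : is_product_measure mu nu pi)
    (hL : 0 < L)
    (hfin : forall S : {set M}, f_int pi g m L S \is a fin_num) :
  let f := fun S : {set M} => fine (f_int pi g m L S) in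
  [/\ normalized f, monotone_nondecreasing f & submodular f].
Proof.
apply: (@integral_submodular _ _ _ _ pi _ (fun z S => g_pair g m L z.1 z.2 S))
  => //.
- exact: measurable_neq.
- by move=> S; apply: measurable_funTS; exact: measurable_g_pair.
- move=> z.
  rewrite (_ : (fun S => _) = fun S : {set M} => Num.min
    (\sum_(j in S) norm2 ((m j z.1 : 'rV_(d j)) - (m j z.2 : 'rV_(d j))) ^+ 2
       / norm2 ((g z.1 : 'rV_q) - (g z.2 : 'rV_q)) ^+ 2) (1 / L ^+ 2)).
    by apply: truncated_sum_submodular => [|j];
      rewrite divr_ge0 ?sqr_ge0.
  by apply/funext => S; rewrite g_pairE.
Qed.
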